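(* Let $H$ be a bipartite graph. If $G$ is a graph with maximum degree $\Delta$ that does not contain $H$ as a subgraph, then $a'(G) \leq 3\Delta + o(\Delta)$.
   Context: All graphs are finite, undirected, and simple. An edge coloring of a graph $G$ is called an acyclic edge coloring if it is proper (adjacent edges receive different colors) and every cycle in $G$ contains edges of at least three different colors. The acyclic chromatic index $a'(G)$ is the least number of colors needed for an acyclic edge coloring of $G$. ''Contains $H$ as a subgraph'' means as a not necessarily induced subgraph. The term $o(\Delta)$ denotes a function of $\Delta$, which depends on $H$ (but not otherwise on $G$), whose ratio to $\Delta$ tends to $0$ as $\Delta \to \infty$. *)

(* Defs.v *)
From HB Require Import structures.
From mathcomp Require Import all_boot all_order all_algebra.
From mathcomp Require Import boolp.

Set Implicit Arguments.
Unset Strict Implicit.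
Unset Printing Implicit Defensive.

Record sgraph := SGraph {
  vertex :> finType;
  adj : rel vertex;
  adj_sym : symmetric adj;
  adj_irr : irreflexive adj }.

Definition edges (G : sgraph) : {set {set G}} :=
  [set [set x; y] | x in G, y in G & adj x y].

Definition max_degree (G : sgraph) : nat :=
  \max_(x : G) #|[set y : G | adj x y]|.

Definition bipartite (G : sgraph) : Prop :=
  exists A : {set G}, forall x y : G, adj x y -> (x \in A) != (y \in A).

(* Not necessarily induced: non-edges of H are unconstrained. *)
Definition contains_subgraph (G H : sgraph) : Prop :=
  exists2 f : H -> G, injective f & forall x y : H, adj x y -> adj (f x) (f y).

(* Edge colorings are total functions on vertex sets; only their values on
   [edges G] matter. *)
Definition proper_edge_coloring (G : sgraph) (c : {set G} -> nat) : Prop :=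
  forall f g : {set G}, f \in edges G -> g \in edges G ->
    f != g -> f :&: g != set0 -> c f != c g.

(* A cycle of G is the cyclic sequence p of its vertices; its edges are the
   pairs of a vertex of p and its cyclic successor. *)
Definition is_cycle (G : sgraph) (p : seq G) : Prop :=
  [/\ 2 < size p, cycle (@adj G) p & uniq p].

Definition cycle_edges (G : sgraph) (p : seq G) : seq {set G} :=
  [seq [set x; next p x] | x <- p].

Definition acyclic_edge_coloring (G : sgraph) (c : {set G} -> nat) : Prop :=
  proper_edge_coloring c /\
  forall p : seq G, is_cycle p -> 3 <= size (undup (map c (cycle_edges p))).

Definition acyclic_edge_colorable (G : sgraph) (k : nat) : Prop :=
  exists2 c : {set G} -> nat,
    acyclic_edge_coloring c & forall f, f \in edges G -> c f < k.

Lemma cycle_edges_sub (G : sgraph) (p : seq G) :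
  is_cycle p -> {subset cycle_edges p <= edges G}.
Proof.
move=> [_ cp _] f /mapP[x xp ->].
by apply/imset2P; exists x (next p x); rewrite // inE; apply: next_cycle.
Qed.

Lemma acyclic_edge_colorable_ex (G : sgraph) :
  exists k, `[< acyclic_edge_colorable G k >].
Proof.
exists (size (enum (edges G))); apply/asboolP.
pose c f := index f (enum (edges G)).
have cinj : {in edges G &, injective c}.
  move=> f g fE gE cfg.
  by rewrite -(@nth_index _ f f (enum (edges G))) ?mem_enum // -/(c f) cfg
    nth_index ?mem_enum.
exists c; last by move=> f fE; rewrite index_mem mem_enum.
split=> [f g fE gE fg _|p pC]; first by apply: contra fg => /eqP /cinj ->.
have sub := cycle_edges_sub pC.
have -> : size (undup (map c (cycle_edges p))) = size (undup (cycle_edges p)).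
  apply/eqP; rewrite -(size_map c); apply/eqP/perm_size/uniq_perm.
  - exact: undup_uniq.
  - rewrite map_inj_in_uniq ?undup_uniq // => f g.
    by rewrite !mem_undup => /sub fE /sub gE; apply: cinj.
  - move=> n; rewrite mem_undup; apply/mapP/mapP => -[f fp ->]; exists f => //.
      by rewrite mem_undup.
    by rewrite mem_undup in fp.
case: pC {sub} => sp _; case: p sp => [|x [|y [|z q]]] // _ up.
have [xy xz yz] : [/\ x != y, x != z & y != z].
  by move: up; rewrite /= !inE !negb_or -!andbA => /and5P[-> -> _ -> _].
set p := [:: x, y, z & q] in up *.
pose w := next p z.
have nx : next p x = y by rewrite /= eqxx.
have ny : next p y = z by rewrite /= eq_sym (negbTE xy) eqxx.
have wy : w != y.
  apply/negP => /eqP wy; have := prev_next up z; rewrite -/w wy -nx.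
  by rewrite (prev_next up) => /eqP; rewrite (negbTE xz).
have -> : 3 = size [:: [set x; y]; [set y; z]; [set z; w]] by [].
apply: uniq_leq_size.
  rewrite /= !inE negb_or andbT -andbA; apply/and3P; split.
  - apply/eqP => /setP /(_ x); rewrite !inE eqxx /=.
    by rewrite (negbTE xy) (negbTE xz).
  - apply/eqP => /setP /(_ z); rewrite !inE eqxx /=.
    by rewrite eq_sym (negbTE xz) eq_sym (negbTE yz).
  - apply/eqP => /setP /(_ y); rewrite !inE eqxx /=.
    by rewrite (negbTE yz) eq_sym (negbTE wy).
move=> f; rewrite mem_undup !inE => /or3P[]/eqP->; rewrite ?nx ?ny eqxx ?orbT //.
Qed.

Definition acyclic_chromatic_index (G : sgraph) : nat :=
  ex_minn (acyclic_edge_colorable_ex G).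

(* Main.v *)
Require Import Defs.
From HB Require Import structures.
From mathcomp Require Import all_boot.
From mathcomp Require Import boolp zify.

Set Implicit Arguments.
Unset Strict Implicit.
Unset Printing Implicit Defensive.

(** The proof counts colorings instead of analysing a random procedure.

    Write [C S] for the number of acyclic edge colorings, with a fixed palette
    of [3 Delta + 2 b] colors, of the subgraph with edge set [S].  The heart is
    the growth inequality [(Delta + b) * C (S - e) <= C S]
    ([coloring_growth]), proved by induction on [S].  A coloring of [S - e] has
    at least [Delta + 2 b] proper extensions to [e], since [e] meets at most
    [2 Delta] other edges ([card_extensions]).  The extensions that fail to be
    acyclic contain a two-colored cycle through [e].  Fix such a cycle, of
    length [l + 4].  In a proper two-colored cycle the colors alternate, so two
    consecutive edges determine all others; erasing the [l + 2] others gives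
    an injection into the colorings of a set obtained from [S - e] by deleting
    [l + 1] edges.  By the induction hypothesis there are at most
    [C (S - e) / (Delta + b) ^ (l + 1)] of these ([card_bad_extensions]).

    Suppose that any two vertices are joined by at most [M] walks with three
    edges.  Then there are at most [2 M Delta ^ l] such cycles, and a geometric
    series bounds the number of bad extensions by [(2 M / b) * C (S - e)], hence
    by [b * C (S - e)] as soon as [2 M <= b ^ 2].  This leaves the
    [(Delta + b) * C (S - e)] good ones, and a coloring of the whole graph
    exists ([few_three_paths_colorable]).

    The bipartite graph [H] enters only through [M].  A walk [x, a, b, y] is an
    edge [ab] between the neighbourhoods of [x] and [y]; if these two sets of
    size at most [Delta] spanned a positive proportion of [Delta ^ 2] edges,
    then the theorem of Kovari, Sos and Turan ([dense_complete_bipartite])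
    would give a complete bipartite subgraph containing [H].  Hence
    [M = o(Delta ^ 2)], and [b = o(Delta)] can be chosen
    ([index_asymptotic_bound]). *)

(** * Edges of paths and cycles *)

Section PathEdges.
Variable G : sgraph.
Implicit Types (x y u v : G) (s p q : seq G).

Definition path_edges x s : seq {set G} :=
  pairmap (fun a b => [set a; b]) x s.

Lemma mem_path_edges x s y f :
  f \in path_edges x s -> y \in f -> y \in x :: s.
Proof.
elim: s x => //= z s IH x; rewrite inE => /orP[/eqP->|fs yf].
  by rewrite !inE => /orP[]->; rewrite ?orbT.
by rewrite inE IH ?orbT.
Qed.

Lemma path_edges_uniq x s : uniq (x :: s) -> uniq (path_edges x s).
Proof.
elim: s x => //= z s IH x /andP[xzs uzs]; rewrite IH // andbT.
by apply: contra xzs => /mem_path_edges; apply; rewrite !inE eqxx.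
Qed.

(** Cutting the cycle at [x] turns questions about [next] into inductions along
    a list that closes up at [x]. *)
Lemma cycle_edgesE x s :
  uniq (x :: s) -> cycle_edges (x :: s) = path_edges x (rcons s x).
Proof.
move=> us; apply: (@eq_from_nth _ set0).
  by rewrite size_map size_pairmap size_rcons.
move=> i; rewrite size_map => li; rewrite (nth_map x) //.
rewrite (@nth_pairmap _ x) ?size_rcons // next_nth mem_nth // index_uniq //.
rewrite -rcons_cons !nth_rcons /= li if_same.
by case: ltnP => // le_si; rewrite [nth x s i]nth_default.
Qed.

End PathEdges.

(** * Colorings of a set of edges *)

Section Counting.
Variables (G : sgraph) (T : finType) (t0 : T).
Implicit Types (x y u v : G) (s p q : seq G) (e f g : {set G}) (S : {set {set G}}).
Implicit Types (c : {ffun {set G} -> T}).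

Definition proper_on S c : Prop :=
  forall f g, f \in S -> g \in S -> f != g -> f :&: g != set0 -> c f != c g.

Definition acyclic_on S c : Prop :=
  forall p, is_cycle p -> {subset cycle_edges p <= S} ->
    2 < size (undup (map c (cycle_edges p))).

(** Fixing the value [t0] outside of [S] makes each partial coloring of [S] a
    single function, so that cardinals count partial colorings. *)
Definition supported_on S c : bool := [forall f, (f \notin S) ==> (c f == t0)].

Definition colorings S : {set {ffun {set G} -> T}} :=
  [set c | supported_on S c && `[< proper_on S c /\ acyclic_on S c >]].

Definition restrict S c : {ffun {set G} -> T} :=
  [ffun f => if f \in S then c f else t0].

Lemma supported_restrict S c : supported_on S (restrict S c).
Proof. by apply/forallP => f; apply/implyP => /negbTE fS; rewrite ffunE fS. Qed.

Lemma restrict_id S c : supported_on S c -> restrict S c = c.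
Proof.
move=> /forallP sc; apply/ffunP => f; rewrite ffunE; case: ifPn => // fS.
by have /implyP/(_ fS)/eqP := sc f.
Qed.

Lemma proper_on_restrict S c : proper_on S (restrict S c) <-> proper_on S c.
Proof.
by split=> cp f g fS gS fg fIg; have := cp f g fS gS fg fIg;
  rewrite !ffunE fS gS.
Qed.

Lemma acyclic_on_restrict S c : acyclic_on S (restrict S c) <-> acyclic_on S c.
Proof.
have E p : {subset cycle_edges p <= S} ->
    map (restrict S c) (cycle_edges p) = map c (cycle_edges p).
  by move=> pS; apply/eq_in_map => f /pS fS; rewrite ffunE fS.
by split=> ca p pC pS; have := ca p pC pS; rewrite E.
Qed.

Lemma restrict_coloring S S' c :
  proper_on S c -> acyclic_on S c -> S' \subset S ->
  restrict S' c \in colorings S'.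
Proof.
move=> cp ca /subsetP sS; rewrite inE supported_restrict; apply/asboolP; split.
  by apply/proper_on_restrict => f g /sS fS /sS gS; apply: cp.
by apply/acyclic_on_restrict => p pC pS; apply: ca => // f /pS/sS.
Qed.

Lemma restrictS S S' c : S' \subset S -> restrict S' (restrict S c) = restrict S' c.
Proof.
move=> /subsetP sS; apply/ffunP => f; rewrite !ffunE; case: ifP => // fS.
by rewrite sS.
Qed.

Lemma colorings_set0 : 0 < #|colorings set0|.
Proof.
apply/card_gt0P; exists (restrict set0 [ffun=> t0]).
apply: (@restrict_coloring set0) => //.
  by move=> f g; rewrite inE.
move=> [|x p] [] // _ _ _ /(_ [set x; next (x :: p) x]) => /(_ (mem_head _ _)).
  by rewrite inE.
Qed.

(** * Proper extensions to one more edge *)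

Definition extensions S e : {set {ffun {set G} -> T}} :=
  [set c | [&& supported_on S c, restrict (S :\ e) c \in colorings (S :\ e)
             & `[< proper_on S c >]]].

Lemma card_incident Delta u : (forall x, #|[set y | adj x y]| <= Delta) ->
  #|[set f in edges G | u \in f]| <= Delta.
Proof.
move=> degG; apply: leq_trans (degG u).
apply: leq_trans (leq_imset_card (fun y => [set u; y]) _); apply: subset_leq_card.
apply/subsetP => f; rewrite inE => /andP[/imset2P[x y _]].
rewrite inE => /andP[_ xy] ->; rewrite !inE => /orP[]/eqP->.
  by apply: imset_f; rewrite inE.
by rewrite setUC; apply: imset_f; rewrite inE adj_sym.
Qed.

(** The color of [e] only has to avoid the colors of the edges that meet [e],
    at most [Delta] at each of its two ends. *)
Lemma card_extensions Delta Q S e :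
  (forall x, #|[set y | adj x y]| <= Delta) -> Delta + Delta + Q <= #|T| ->
  S \subset edges G -> e \in S ->
  #|colorings (S :\ e)| * Q <= #|extensions S e|.
Proof.
move=> degG leT SE eS.
pose nbrs := [set f in S :\ e | f :&: e != set0].
have nbrs_card : #|nbrs| <= Delta + Delta.
  have /imset2P[u v _] := subsetP SE _ eS; rewrite inE => _ Euv.
  apply: leq_trans (leq_add (card_incident u degG) (card_incident v degG)).
  apply: leq_trans (leq_card_setU _ _); apply: subset_leq_card.
  apply/subsetP => f; rewrite inE => /andP[/setD1P[_ /(subsetP SE) fE]].
  case/set0Pn => x /setIP[xf]; rewrite Euv => /set2P[]E; subst x;
  by rewrite !inE fE xf ?orbT.
pose allowed c := ~: [set c f | f in nbrs].
have allowed_card c : Q <= #|allowed c|.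
  rewrite -(leq_add2l (Delta + Delta)); apply: leq_trans leT _.
  rewrite -(cardsC [set c f | f in nbrs]) leq_add2r.
  exact: leq_trans (leq_imset_card _ _) nbrs_card.
rewrite -[#|extensions S e|]sum1_card.
rewrite (partition_big (restrict (S :\ e)) (mem (colorings (S :\ e)))) /=; last first.
  by move=> c; rewrite inE => /and3P[].
rewrite -sum_nat_const; apply: leq_sum => c cC.
have := cC; rewrite inE => /andP[csupp /asboolP[cp ca]].
pose ext k : {ffun {set G} -> T} := [ffun f => if f == e then k else c f].
have ext_inj : injective ext.
  by move=> k1 k2 /ffunP/(_ e); rewrite !ffunE eqxx.
apply: leq_trans (allowed_card c) _.
rewrite sum1_card -(card_imset _ ext_inj); apply: subset_leq_card.
apply/subsetP => _ /imsetP[k kA ->].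
have Er : restrict (S :\ e) (ext k) = c.
  rewrite -[RHS](restrict_id csupp); apply/ffunP => f; rewrite !ffunE.
  by case: ifP => // /setD1P[/negbTE-> _].
rewrite unfold_in /= Er eqxx andbT inE Er cC; apply/andP; split.
  apply/forallP => f; apply/implyP => fS; rewrite ffunE; case: (eqVneq f e) => [fe|fe].
    by rewrite fe eS in fS.
  by have /forallP/(_ f)/implyP-> := csupp; rewrite // !inE fe.
rewrite /=; apply/asboolP.
have kP f : f \in S -> f != e -> f :&: e != set0 -> k != c f.
  move=> fS fe fIe; apply: contraTneq kA => ->; rewrite inE negbK imset_f //.
  by rewrite !inE fe fS.
move=> f g fS gS; rewrite !ffunE.
case: (eqVneq f e) => [->|fe]; case: (eqVneq g e) => [->|ge] fg fIg.
- by [].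
- by apply: kP; rewrite // setIC.
- by rewrite eq_sym; apply: kP.
- by apply: cp; rewrite // !inE ?fe ?ge.
Qed.

(** * Extensions with a two-colored cycle *)

Lemma proper_on_path S c x s : proper_on S c -> uniq (x :: s) ->
  {subset path_edges x s <= S} ->
  sorted (fun a b => a != b) (map c (path_edges x s)).
Proof.
move=> cp; elim: s x => // y [|z s] IH x //.
move=> /andP[xN us] sS.
have sS' : {subset path_edges y (z :: s) <= S}.
  by move=> f fs; apply: sS; rewrite inE fs orbT.
rewrite /= -/(path_edges z s); apply/andP; split; last exact: IH.
apply: cp; [exact/sS/mem_head|exact/sS'/mem_head| |].
  apply: contraNneq xN => /setP/(_ x); rewrite !inE eqxx /= => /esym/orP[]->//.
  by rewrite orbT.
by apply/set0Pn; exists y; rewrite !inE eqxx orbT.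
Qed.

Definition bad_extensions S e p : {set {ffun {set G} -> T}} :=
  [set c in extensions S e | `[< [/\ is_cycle p, {subset cycle_edges p <= S}
                             & size (undup (map c (cycle_edges p))) <= 2] >]].

(** A coloring that is acyclic without [e] can only fail on a cycle through [e];
    rotating that cycle makes [e] its first edge.  Either end of [e] can come
    first, so both orientations have to be counted later. *)
Lemma extensions_cover S e c : e \in S ->
  c \in extensions S e -> c \notin colorings S ->
  exists u v q, [/\ e = [set u; v], u != v & c \in bad_extensions S e [:: u, v & q]].
Proof.
move=> eS cE; have := cE; rewrite inE => /and3P[csupp cD /asboolP cp].
rewrite inE csupp /= => /asboolPn; rewrite not_andP => -[//|].
rewrite /acyclic_on => /existsNP[p]; rewrite not_implyE => -[pC].
rewrite not_implyE => -[pS]; move=> /negP; rewrite -leqNgt => p2.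
have ep : e \in cycle_edges p.
  have [//|eNp] := boolP (e \in cycle_edges p).
  have := cD; rewrite inE => /andP[_ /asboolP[_ /acyclic_on_restrict ca]].
  have := ca p pC; rewrite ltnNge p2 => /(_ _)/notF; case=> f fp.
  by rewrite !inE pS // andbT; apply: contraNneq eNp => <-.
have [p_gt2 adjp up] := pC.
case/mapP: ep => u up_ Ee.
have [i q def_p] := rot_to up_.
have Eq : cycle_edges (u :: q) = rot i (cycle_edges p).
  rewrite /cycle_edges -def_p map_rot; congr rot; apply: eq_map => x.
  by rewrite next_rot.
have Cq : is_cycle (u :: q).
  by rewrite -def_p; split; rewrite ?size_rot ?rot_cycle ?rot_uniq.
case: q => [|v q] in def_p Eq Cq *; first by case: Cq.
have Ev : next p u = v by rewrite -(next_rot i up) def_p /= eqxx.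
exists u, v, q; split; first by rewrite Ee Ev.
  by case: Cq => _ _ /=; rewrite inE negb_or -andbA => /and3P[].
rewrite inE cE; apply/asboolP; split => //; rewrite Eq.
  by move=> f; rewrite mem_rot => /pS.
rewrite map_rot (perm_size (perm_undup (mem_rot _ _))).
exact: p2.
Qed.

(** A proper coloring gives a triangle three colors. *)
Lemma bad_extensions_size S u v q c :
  c \in bad_extensions S [set u; v] [:: u, v & q] -> 1 < size q.
Proof.
rewrite !inE => /andP[/and3P[_ _ /asboolP cp] /asboolP[pC pS p2]].
rewrite ltnNge; apply/negP => q1.
have [p_gt2 _ up] := pC.
case: q => [|a [|]] // in p_gt2 q1 pC pS p2 up *.
rewrite cycle_edgesE //= in pS p2.
move: up; rewrite /= !inE negb_or => /and3P[/andP[uv ua] va _].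
have P f g : f \in [:: [set u; v]; [set v; a]; [set a; u]] ->
   g \in [:: [set u; v]; [set v; a]; [set a; u]] -> f != g -> f :&: g != set0 -> c f != c g.
  by move=> /pS fS /pS gS; apply: cp.
have N1 : c [set u; v] != c [set v; a].
  apply: P; rewrite ?inE ?eqxx ?orbT //.
    apply: contraNneq uv => /setP/(_ u); rewrite !inE eqxx /= => /esym/orP[|]//.
    by rewrite (negbTE ua).
  by apply/set0Pn; exists v; rewrite !inE eqxx ?orbT.
have N2 : c [set u; v] != c [set a; u].
  apply: P; rewrite ?inE ?eqxx ?orbT //.
    apply: contraNneq va => /setP/(_ v); rewrite !inE eqxx orbT => /esym/orP[|]//.
    by rewrite eq_sym (negbTE uv).
  by apply/set0Pn; exists u; rewrite !inE eqxx ?orbT.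
have N3 : c [set v; a] != c [set a; u].
  apply: P; rewrite ?inE ?eqxx ?orbT //.
    apply: contraNneq va => /setP/(_ v); rewrite !inE eqxx => /esym/orP[|]//.
    by rewrite eq_sym (negbTE uv).
  by apply/set0Pn; exists a; rewrite !inE eqxx ?orbT.
by move: p2; rewrite !inE (negbTE N1) (negbTE N2) (negbTE N3).
Qed.

(** Along a sequence without equal neighbours and with two values only, each
    term is the value that the preceding term does not take. *)
Lemma two_valued_det (x y z : T) (s t : seq T) :
  {subset s <= [:: x; y]} -> {subset t <= [:: x; y]} ->
  z \in [:: x; y] -> size s = size t ->
  path (fun a b => a != b) z s -> path (fun a b => a != b) z t -> s = t.
Proof.
elim: s t z => [|a s IH] [|b t] z //= ss st zxy [sz] /andP[za ps] /andP[zb pt].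
have ab : a = b.
  have := ss _ (mem_head _ _); have := st _ (mem_head _ _).
  move: zxy za zb; rewrite !inE.
  move=> zxy + + hb ha; case/orP: zxy => /eqP->; case/orP: ha => /eqP->;
    by case/orP: hb => /eqP->; rewrite ?eqxx.
rewrite -ab in pt *; congr cons; apply: (IH t a) => //.
- by move=> d ds; apply: ss; rewrite inE ds orbT.
- by move=> d ds; apply: st; rewrite inE ds orbT.
- exact/ss/mem_head.
Qed.

(** Name the cycle [u, v, a, b, ...], with [e = uv].  The colors of the edges
    [va] and [ab] determine the colors of [e] and of the path [tail] from [b]
    back to [u], so restricting to the complement of [e] and [tail] loses
    nothing.  The restrictions are colorings of [S - e - tail], and each of the
    [l.+1] edges of [tail] gains a factor [beta] by the growth hypothesis. *)
Lemma card_bad_extensions beta l S u v q :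
  (forall S' f, S' \subset S :\ [set u; v] -> f \in S' ->
     beta * #|colorings (S' :\ f)| <= #|colorings S'|) ->
  size q = l.+2 ->
  beta ^ l.+1 * #|bad_extensions S [set u; v] [:: u, v & q]|
    <= #|colorings (S :\ [set u; v])|.
Proof.
set e := [set u; v]; move=> IH.
case: q => [|a [|b r]] //= [] sr.
(* A bad extension shows that the vertex sequence is a cycle inside [S]. *)
have [->|[c0 c0B]] := set_0Vmem (bad_extensions S e [:: u, v, a, b & r]).
  by rewrite cards0 muln0.
have := c0B; rewrite inE => /andP[_ /asboolP[pC pS _]].
have [_ _ up] := pC.
pose tail := path_edges b (rcons r u).
have Ep : cycle_edges [:: u, v, a, b & r] = [:: e, [set v; a], [set a; b] & tail].
  by rewrite cycle_edgesE.
have uvr : uniq [:: v, a, b & rcons r u].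
  by have := up; rewrite -(rot_uniq 1) rot1_cons.
pose D := [set f in tail].
have cardD : #|D| = l.+1.
  rewrite cardsE; have /card_uniqP-> : uniq tail.
    by apply: path_edges_uniq; move: uvr => /= /and3P[].
  by rewrite size_pairmap size_rcons sr.
have vN f : f \in tail -> v \notin f.
  move=> ft; move: uvr => /= /andP[+ _]; apply: contra => vf.
  by rewrite inE (mem_path_edges ft vf) orbT.
have aN f : f \in tail -> a \notin f.
  move=> ft; move: uvr => /= /and3P[_ + _]; apply: contra => af.
  by rewrite (mem_path_edges ft af).
have chain (F S' : {set {set G}}) : F \subset S' -> S' \subset S :\ e ->
    beta ^ #|F| * #|colorings (S' :\: F)| <= #|colorings S'|.
  move: {2}#|F| (erefl #|F|) => n; elim: n F => [|n IHn] F.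
    by move/eqP; rewrite cards_eq0 => /eqP-> _ _; rewrite cards0 setD0 mul1n.
  move=> Fn FS S'S; have /card_gt0P[f fF] : 0 < #|F| by rewrite Fn.
  have Fn' : #|F :\ f| = n by have := cardsD1 f F; rewrite fF Fn => -[].
  have := IHn _ Fn' (subset_trans (subsetDl _ _) FS) S'S.
  apply: leq_trans; rewrite Fn' Fn expnSr -mulnA leq_mul2l.
  have -> : S' :\: F = (S' :\: (F :\ f)) :\ f.
    by rewrite setDDl setUC setD1K.
  apply/orP; right; apply: IH; first exact: subset_trans (subsetDl _ _) S'S.
  by rewrite !inE eqxx (subsetP FS).
have DS : D \subset S :\ e.
  apply/subsetP => f; rewrite !inE => ft; apply/andP; split.
    by apply: contraTneq (vN _ ft) => ->; rewrite negbK !inE eqxx orbT.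
  by apply: pS; rewrite Ep !inE ft !orbT.
have := chain D (S :\ e) DS (subxx _); rewrite cardD; apply: leq_trans.
rewrite leq_mul2l; apply/orP; right.
set S0 := (S :\ e) :\: D.
have va_S0 : [set v; a] \in S0.
  rewrite !inE pS ?Ep ?inE ?eqxx ?orbT // andbT; apply/andP; split.
    by apply/negP => /vN; rewrite !inE eqxx.
  apply/eqP => /setP/(_ u); rewrite !inE eqxx /=.
  move: up; rewrite /= !inE !negb_or -!andbA => /and3P[uv ua _].
  by rewrite (negbTE uv) (negbTE ua).
have ab_S0 : [set a; b] \in S0.
  rewrite !inE pS ?Ep ?inE ?eqxx ?orbT // andbT; apply/andP; split.
    by apply/negP => /aN; rewrite !inE eqxx.
  apply/eqP => /setP/(_ u); rewrite !inE eqxx /=.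
  move: up; rewrite /= !inE !negb_or -!andbA => /and4P[uv ua ub _].
  by rewrite (negbTE ub) (negbTE ua).
rewrite -(@card_in_imset _ _ (restrict S0)); last first.
  move=> c c' cB c'B Ecc'.
  have facts d : d \in bad_extensions S e [:: u, v, a, b & r] ->
     [/\ supported_on S d, d e != d [set v; a], d [set v; a] != d [set a; b],
     path (fun a b => a != b) (d [set a; b]) (map d tail) &
     forall f, f \in e :: tail -> d f \in [:: d [set v; a]; d [set a; b]]].
    rewrite !inE => /andP[/and3P[dsupp _ /asboolP dp] /asboolP[_ _ d2]].
    have := @proper_on_path S d v [:: a, b & rcons r u] dp uvr.
    rewrite /= -/tail => /(_ _)/andP[|N1 N2].
      by move=> f ft; apply: pS; rewrite Ep inE ft orbT.
    have := @proper_on_path S d u [:: v; a] dp.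
    rewrite /= => /(_ _ _)/andP[| |N0 _].
    - by move: up; rewrite /= !inE !negb_or -!andbA => /and5P[-> -> _ _ /andP[-> _]].
    - by move=> f; rewrite !inE => /orP[]/eqP->; apply: pS; rewrite Ep !inE eqxx ?orbT.
    split=> // f ft.
    have u2 : uniq [:: d [set v; a]; d [set a; b]] by rewrite /= inE N1.
    have [|_ ->] := uniq_min_size u2 _ d2.
      move=> k; rewrite mem_undup Ep !inE => /orP[]/eqP->;
      by rewrite /= eqxx ?orbT.
    rewrite mem_undup map_f // Ep; move: ft; rewrite !inE => /orP[->//|->].
    by rewrite !orbT.
  have agree f : f \in S0 -> c f = c' f.
    by move=> fS0; have /ffunP/(_ f) := Ecc'; rewrite !ffunE fS0.
  have [csupp ce cva cpath ctwo] := facts c cB.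
  have [c'supp c'e c'va c'path c'two] := facts c' c'B.
  have Etail : map c tail = map c' tail.
    apply: (@two_valued_det (c [set v; a]) (c [set a; b]) (c [set a; b])).
    - by move=> _ /mapP[f ft ->]; apply: ctwo; rewrite inE ft orbT.
    - by move=> _ /mapP[f ft ->]; rewrite !agree //; apply: c'two; rewrite inE ft orbT.
    - by rewrite !inE eqxx orbT.
    - by rewrite !size_map.
    - exact: cpath.
    - by rewrite agree.
  rewrite -(restrict_id csupp) -(restrict_id c'supp).
  apply/ffunP => f; rewrite !ffunE; case: ifP => // fS.
  have [fD|fND] := boolP (f \in tail).
    by move/eq_in_map: Etail; apply.
  have [->|fe] := eqVneq f e; last by apply: agree; rewrite !inE fND fe.
  have := ctwo e (mem_head _ _); have := c'two e (mem_head _ _).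
  rewrite !inE (negbTE ce) (negbTE c'e) /= => /eqP-> /eqP->.
  by rewrite agree.
apply: subset_leq_card; apply/subsetP => _ /imsetP[c cB ->].
have := cB; rewrite inE => /andP[+ _]; rewrite inE => /and3P[_ cD _].
rewrite -(restrictS _ (subsetDl _ _ : S0 \subset S :\ e)).
have := cD; rewrite inE => /andP[_ /asboolP[cp ca]].
exact: restrict_coloring cp ca (subsetDl _ _).
Qed.

(** * Counting the cycles through an edge *)

Definition three_paths x u : {set G * G} :=
  [set ab | [&& adj x ab.1, adj ab.1 ab.2 & adj ab.2 u]].

(** The interior vertices of the walks from [x] to [u] with [l + 3] edges: [l]
    free steps followed by a walk with three edges. *)
Fixpoint walks l x u : seq (seq G) :=
  if l is l'.+1 then
    flatten [seq [seq y :: q | q <- walks l' y u] | y <- enum [set y | adj x y]]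
  else [seq [:: ab.1; ab.2] | ab <- enum (three_paths x u)].

Lemma mem_walks l x u q :
  size q = l.+2 -> path (@adj G) x q -> adj (last x q) u -> q \in walks l x u.
Proof.
elim: l x q => [|l IH] x.
  move=> [|a [|b []]] //= _ /and3P[xa ab _] bu.
  by apply/mapP; exists (a, b); rewrite // mem_enum inE /= xa ab.
move=> [|a q] //= [sq] /andP[xa aq] qu.
apply/flattenP; exists [seq a :: q' | q' <- walks l a u].
  by apply/mapP; exists a; rewrite // mem_enum inE.
by rewrite map_f // IH.
Qed.

Lemma size_mem_walks l x u q : q \in walks l x u -> size q = l.+2.
Proof.
elim: l x q => [|l IH] x q /=; first by case/mapP=> ab _ ->.
by case/flattenP => s /mapP[y _ ->] /mapP[q' /IH sq ->]; rewrite /= sq.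
Qed.

Lemma size_walks Delta M l x u :
  (forall x, #|[set y | adj x y]| <= Delta) ->
  (forall x u, #|three_paths x u| <= M) ->
  size (walks l x u) <= M * Delta ^ l.
Proof.
move=> degG three; elim: l x => [|l IH] x.
  by rewrite size_map -cardE muln1.
rewrite size_flatten sumnE !big_map.
rewrite (leq_trans (n := \sum_(y in [set y | adj x y]) M * Delta ^ l)) //.
  rewrite -[X in _ <= X]big_enum /=; apply: leq_sum => y _.
  by rewrite size_map.
by rewrite sum_nat_const expnS [M * (_ * _)]mulnCA leq_mul2r degG orbT.
Qed.

(** The sum of [A * Delta ^ l / (Delta + b) ^ l.+1] over all [l] is [A / b].
    Multiplying by [(Delta + b) ^ L] keeps the computation in [nat], where
    the series becomes a factorization of a difference of powers. *)
Lemma geometric_sum_bound (Delta b A C L : nat) (t : nat -> nat) :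
  A <= b ^ 2 -> 0 < b ->
  (forall l, l < L -> (Delta + b) ^ l.+1 * t l <= A * Delta ^ l * C) ->
  \sum_(l < L) t l <= b * C.
Proof.
move=> Ab b_gt0 tP; set beta := Delta + b in tP *.
have beta_gt0 : 0 < beta by rewrite addn_gt0 b_gt0 orbT.
have step : beta ^ L * (\sum_(l < L) t l) <=
    A * C * \sum_(l < L) beta ^ (L.-1 - l) * Delta ^ l.
  rewrite !big_distrr /=; apply: leq_sum => l _.
  have -> : beta ^ L = beta ^ (L.-1 - l) * beta ^ l.+1.
    by rewrite -expnD -subn1 -subnDA add1n subnK.
  rewrite -mulnA [A * C * _]mulnCA leq_mul2l; apply/orP; right.
  by rewrite [A * C * _]mulnAC tP.
have geo : b * (\sum_(l < L) beta ^ (L.-1 - l) * Delta ^ l) <= beta ^ L.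
  have := subn_exp beta Delta L; rewrite {1}/beta addKn => geo.
  apply: leq_trans (leq_subr (Delta ^ L) _); rewrite geo leq_mul2l.
  by apply/orP; right; apply: leq_sum => l _; rewrite -subn1 -subnDA add1n.
rewrite -(leq_pmul2l (m := beta ^ L)) ?expn_gt0 ?beta_gt0 //.
rewrite -(leq_pmul2l b_gt0) (leq_trans (leq_mul (leqnn b) step)) //.
rewrite mulnCA (leq_trans (leq_mul (leqnn _) geo)) //.
rewrite (_ : b * _ = b ^ 2 * C * beta ^ L); last by rewrite mulnCA mulnC mulnA.
by rewrite !leq_mul.
Qed.

(** * The growth inequality *)

(** Of the [Delta + 2 * b] proper extensions per coloring, the bad ones use up
    at most [b] on average. *)
Lemma coloring_growth Delta M b S e :
  (forall x, #|[set y | adj x y]| <= Delta) ->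
  (forall x u, #|three_paths x u| <= M) ->
  2 * M <= b ^ 2 -> 0 < b -> 3 * Delta + 2 * b <= #|T| ->
  S \subset edges G -> e \in S ->
  (Delta + b) * #|colorings (S :\ e)| <= #|colorings S|.
Proof.
move=> degG three Mb b_gt0 leT; move: {2}#|S|.+1 (ltnSn #|S|) => n.
elim: n S e => // n IHn S e Sn SE eS.
have IH S' f : S' \subset S :\ e -> f \in S' ->
    (Delta + b) * #|colorings (S' :\ f)| <= #|colorings S'|.
  move=> S'S fS'; apply: IHn => //.
    rewrite (leq_trans _ (_ : #|S| <= n)) //.
    by rewrite (leq_ltn_trans (subset_leq_card S'S)) // [X in _ < X](cardsD1 e) eS.
  exact: subset_trans (subset_trans S'S (subsetDl _ _)) SE.
have /imset2P[u v _] := subsetP SE _ eS; rewrite inE => _ Euv.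
(* The cycles through [e] with [l + 4] vertices, started from either end. *)
pose cands l := [seq [:: u, v & q] | q <- walks l v u] ++
                [seq [:: v, u & q] | q <- walks l u v].
pose nbad l := \sum_(p <- cands l) #|bad_extensions S e p|.
have ext_card : #|extensions S e| <= #|colorings S| + \sum_(l < #|G|) nbad l.
  have -> : \sum_(l < #|G|) nbad l =
      \sum_(p <- flatten [seq cands l | l <- iota 0 #|G|]) #|bad_extensions S e p|.
    by rewrite big_flatten /= big_map -[in RHS](subn0 #|G|) big_mkord.
  set ps := flatten _.
  have cov : extensions S e \subset
      colorings S :|: \bigcup_(p <- ps) bad_extensions S e p.
    apply/subsetP => c cE; rewrite in_setU; have [//|cN /=] := boolP (c \in _).
    have [u' [v' [q [E uv' cB]]]] := extensions_cover eS cE cN.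
    have q_gt1 : 1 < size q by move: cB; rewrite {1}E; apply: bad_extensions_size.
    have := cB; rewrite inE => /andP[_ /asboolP[[_ adjq uq] _ _]].
    suff qps : [:: u', v' & q] \in ps.
      by rewrite (big_rem _ qps) /= inE cB.
    apply/flattenP; exists (cands (size q).-2).
      apply/mapP; exists (size q).-2; rewrite // mem_iota /= add0n.
      have := max_card (mem [:: u', v' & q]); rewrite (card_uniqP uq) /=.
      case: (size q) q_gt1 => [|[|k]] //= _; apply: leq_trans.
      by rewrite !ltnS ltnW // ltnW.
    have qW : q \in walks (size q).-2 v' u'.
      move: adjq; rewrite /= rcons_path => /andP[_ /andP[]]; apply: mem_walks.
      by case: (size q) q_gt1 => [|[|k]].
    rewrite mem_cat; have EE : [set u'; v'] = [set u; v] by rewrite -E.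
    have : u' \in [set u; v] by rewrite -EE !inE eqxx.
    have : v' \in [set u; v] by rewrite -EE !inE eqxx orbT.
    case/set2P=> Ev /set2P[] Eu; subst u' v'; rewrite ?eqxx // in uv' *.
      by rewrite [X in _ || X]map_f ?orbT.
    by rewrite map_f.
  apply: leq_trans (subset_leq_card cov) _.
  apply: leq_trans (leq_card_setU _ _) _; rewrite leq_add2l.
  elim: (ps) => [|p ps' IHps]; first by rewrite !big_nil cards0.
  rewrite !big_cons; apply: leq_trans (leq_card_setU _ _) _.
  by rewrite leq_add2l.
have bad_sum : \sum_(l < #|G|) nbad l <= b * #|colorings (S :\ e)|.
  apply: (geometric_sum_bound Mb b_gt0) => l _; rewrite big_distrr /= big_cat !big_map /=.
  rewrite mul2n -addnn !mulnDl.
  have side x y : e = [set x; y] ->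
     \sum_(q <- walks l y x) (Delta + b) ^ l.+1 * #|bad_extensions S e [:: x, y & q]|
       <= M * Delta ^ l * #|colorings (S :\ e)|.
    move=> Exy; apply: leq_trans (leq_mul (size_walks l y x degG three) (leqnn _)).
    rewrite -sum1_size big_distrl /= big_seq [X in _ <= X]big_seq.
    apply: leq_sum => q /size_mem_walks sq; rewrite Exy mul1n.
    by apply: card_bad_extensions => // S' f; rewrite -Exy; exact: IH.
  by apply: leq_add; apply: side; rewrite // setUC.
have leT' : Delta + Delta + (Delta + 2 * b) <= #|T|.
  by rewrite addnA addnn -muln2 -mulnSr mulnC.
have := leq_trans (card_extensions degG leT' SE eS) ext_card.
move/leq_trans/(_ (leq_add (leqnn _) bad_sum)).
rewrite mul2n -addnn addnA mulnDr [b * _]mulnC leq_add2r.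
by rewrite mulnC.
Qed.
End Counting.

Lemma few_three_paths_colorable (G : sgraph) Delta M b :
  (forall x : G, #|[set y | adj x y]| <= Delta) ->
  (forall x u : G, #|three_paths x u| <= M) ->
  2 * M <= b ^ 2 -> 0 < b ->
  acyclic_edge_colorable G (3 * Delta + 2 * b).
Proof.
move=> degG three Mb b_gt0.
have K_gt0 : 0 < 3 * Delta + 2 * b by rewrite addn_gt0 !muln_gt0 b_gt0 orbT.
pose t0 := Ordinal K_gt0.
have pos n (S : {set {set G}}) : #|S| = n -> S \subset edges G -> 0 < #|colorings t0 S|.
  elim: n S => [|n IHn] S.
    by move/eqP; rewrite cards_eq0 => /eqP-> _; apply: colorings_set0.
  move=> Sn SE; have /card_gt0P[e eS] : 0 < #|S| by rewrite Sn.
  have := coloring_growth t0 degG three Mb b_gt0 _ SE eS.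
  rewrite card_ord => /(_ (leqnn _)); apply: leq_trans.
  rewrite muln_gt0 addn_gt0 b_gt0 orbT; apply: IHn.
    by have := cardsD1 e S; rewrite eS Sn => -[].
  exact: subset_trans (subsetDl _ _) SE.
have /card_gt0P[c] := pos _ _ (erefl _) (subxx (edges G)).
rewrite inE => /andP[_ /asboolP[cp ca]].
exists (fun f => val (c f)); last by move=> f _; apply: ltn_ord.
split=> [f g fE gE fg fIg|p pC].
  by rewrite (inj_eq val_inj); apply: cp.
rewrite (map_comp val c) undup_map_inj ?size_map; last exact: val_inj.
by apply: ca => //; apply: cycle_edges_sub.
Qed.

(** * Complete bipartite subgraphs of dense neighbourhoods *)

(** Induction on [s] in place of the usual count of [s]-tuples: double counting
    gives one vertex [b] of [B] joined to at least [#|A| / m] vertices of [A],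
    and the statement for [s] applies to these vertices and to [B] without [b].
    Each remaining degree has dropped by one only, so the single density
    [1 / (2 * m ^ 2)] covers both losses.  The thresholds depend on [s], [t] and
    [m] alone, which makes the final error term uniform over all graphs. *)
Lemma dense_complete_bipartite (s t m : nat) : 0 < m ->
  exists D0, forall D (V : finType) (r : rel V) (A B : {set V}),
    D0 <= D -> #|B| <= D -> D <= m * #|A| ->
    (forall a, a \in A -> D <= m * #|[set b in B | r a b]|) ->
    exists S T : {set V},
      [/\ #|S| = s, #|T| = t, T \subset A, S \subset B &
        forall a b, a \in T -> b \in S -> r a b].
Proof.
elim: s m => [|s IHs] m m_gt0.
  exists (m * t) => D V r A B D0D _ AD _.
  have : t <= #|A| by rewrite -(leq_pmul2l m_gt0) (leq_trans D0D).
  case/card_geqP=> q [uq sq qA]; exists set0, [set x in q].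
  split; rewrite ?cards0 ?sub0set //; last by move=> a b _; rewrite inE.
    by rewrite cardsE (card_uniqP uq).
  by apply/subsetP => x; rewrite inE => /qA.
have m'_gt0 : 0 < 2 * m ^ 2 by rewrite muln_gt0 expn_gt0 m_gt0.
have [D0 D0P] := IHs _ m'_gt0.
exists (maxn D0 (2 * m)).+1 => D V r A B D0D BD AD deg.
have D_gt0 : 0 < D by apply: leq_trans D0D.
have [D0D' mD] : D0 <= D /\ 2 * m <= D.
  by split; apply: leq_trans (ltnW D0D); rewrite ?leq_maxl ?leq_maxr.
have [b bB bdeg] : exists2 b, b \in B & #|A| <= m * #|[set a in A | r a b]|.
  (* Otherwise every degree into [A] is too small for the edge count. *)
  apply/exists_inP; rewrite -[X in is_true X]negbK negb_exists_in.
  apply/negP => /forall_inP no.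
  have dbl : \sum_(a in A) #|[set b in B | r a b]| =
      \sum_(b in B) #|[set a in A | r a b]|.
    rewrite (eq_bigr (fun a => \sum_(b in B) (r a b : nat))); last first.
      by move=> a _; rewrite -sum1dep_card big_mkcondr.
    rewrite exchange_big; apply: eq_bigr => b _.
    by rewrite -sum1dep_card big_mkcondr.
  have low : D * #|A| <= m * \sum_(a in A) #|[set b in B | r a b]|.
    by rewrite mulnC -sum_nat_const big_distrr /=; apply: leq_sum => a; apply: deg.
  have A_gt0 : 0 < #|A| by move: AD; case: #|A| => //; rewrite muln0 leqNgt D_gt0.
  have up : m * \sum_(b in B) #|[set a in A | r a b]| <= #|B| * #|A|.-1.
    rewrite -sum_nat_const big_distrr /=; apply: leq_sum => b bB.
    by have := no b bB; rewrite -ltnNge -(ltn_predK A_gt0) ltnS.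
  have := leq_trans low _; rewrite dbl => /(_ _ up).
  rewrite leqNgt => /negP[]; apply: leq_ltn_trans (leq_mul BD (leqnn _)) _.
  by rewrite ltn_pmul2l // ltn_predL.
pose A1 := [set a in A | r a b].
have [|||S [T [cS cT TA SB ST]]] := D0P D V r A1 (B :\ b) D0D'.
- exact: leq_trans (subset_leq_card (subsetDl _ _)) BD.
- apply: leq_trans AD _; apply: leq_trans (leq_mul (leqnn m) bdeg) _.
  by rewrite mulnA leq_mul2r -mulnn leq_pmull ?orbT.
- move=> a; rewrite inE => /andP[aA ab].
  have := deg a aA; rewrite (cardsD1 b) inE bB ab /=.
  set d := #|_|; have -> : #|[set x in B :\ b | r a x]| = d.
    by apply: eq_card => x; rewrite !inE andbA.
  rewrite mulnDr muln1 => Dd.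
  have : D <= 2 * m * d by lia.
  by move/leq_trans; apply; rewrite leq_mul2r leq_mul2l -mulnn leq_pmull ?orbT.
exists (b |: S), T; split=> //.
- rewrite cardsU1 cS; have -> // : b \notin S.
  by apply/negP => /(subsetP SB); rewrite !inE eqxx.
- by apply: subset_trans TA _; apply/subsetP => x; rewrite inE => /andP[].
- by rewrite subUset sub1set bB (subset_trans SB) // subsetDl.
move=> a x aT /setU1P[->|]; last exact: ST.
by have := subsetP TA _ aT; rewrite inE => /andP[].
Qed.

(** The sides [S] and [T] are disjoint because [G] has no loops, so two
    bijections onto them glue to an injection.  The vertex of [G] serves as a
    default value. *)
Lemma complete_bipartite_contains (G H : sgraph) (P : {set H}) (S T : {set G}) :
  (forall x y : H, adj x y -> (x \in P) != (y \in P)) ->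
  #|S| = #|P| -> #|T| = #|~: P| ->
  (forall a b, a \in T -> b \in S -> adj a b) ->
  G -> contains_subgraph G H.
Proof.
move=> bip cS cT ST d.
pose trans (X : {set H}) (Y : {set G}) x := nth d (enum Y) (index x (enum X)).
have trans_in (X : {set H}) (Y : {set G}) x : #|Y| = #|X| -> x \in X -> trans X Y x \in Y.
  by move=> cXY xX; rewrite -mem_enum mem_nth // -cardE cXY cardE index_mem mem_enum.
have trans_inj (X : {set H}) (Y : {set G}) :
    #|Y| = #|X| -> {in X &, injective (trans X Y)}.
  move=> cXY x y xX yX /eqP.
  rewrite nth_uniq ?enum_uniq -?cardE ?cXY 1?cardE ?index_mem ?mem_enum //.
  by move/eqP; apply: (@index_inj _ x); rewrite mem_enum.
have ST0 z : z \in S -> z \in T -> False.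
  by move=> zS zT; have := ST z z zT zS; rewrite adj_irr.
exists (fun x => if x \in P then trans P S x else trans (~: P) T x).
  move=> x y; case: ifPn => xP; case: ifPn => yP.
  - exact: trans_inj.
  - move=> E; case: (ST0 (trans P S x)); first exact: trans_in.
    by rewrite E; apply: trans_in; rewrite // inE.
  - move=> E; case: (ST0 (trans P S y)); first exact: trans_in.
    by rewrite -E; apply: trans_in; rewrite // inE.
  - by apply: trans_inj; rewrite // inE.
move=> x y /bip; case: ifPn => xP; case: ifPn => yP // _; last first.
  by apply: ST; apply: trans_in; rewrite // inE.
by rewrite adj_sym; apply: ST; apply: trans_in; rewrite // inE.
Qed.

(** If more than [Delta ^ 2 / m] edges join the neighbourhoods of [x] and [u],
    then at least [Delta / (2 * m)] neighbours of [x] have at least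
    [Delta / (2 * m)] neighbours among those of [u]: the other neighbours of [x]
    account for at most half of these edges. *)
Lemma few_three_paths (H : sgraph) (m : nat) : bipartite H -> 0 < m ->
  exists D0, forall (G : sgraph) Delta, D0 <= Delta ->
    (forall x : G, #|[set y | adj x y]| <= Delta) -> ~ contains_subgraph G H ->
    forall x u : G, m * #|three_paths x u| <= Delta ^ 2.
Proof.
move=> [P bip] m_gt0; have m2_gt0 : 0 < 2 * m by rewrite muln_gt0.
have [D0 D0P] := dense_complete_bipartite #|P| #|~: P| m2_gt0.
exists D0 => G Delta D0D degG freeG x u.
pose deg a := #|[set b in [set y | adj u y] | adj a b]|.
have deg_le a : deg a <= Delta.
  apply: leq_trans (degG u); apply: subset_leq_card.
  by apply/subsetP => b; rewrite inE => /andP[].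
pose A := [set a in [set y | adj x y] | Delta <= 2 * m * deg a].
rewrite leqNgt; apply/negP => many; apply: freeG.
have paths_sum : #|three_paths x u| = \sum_(a in [set y | adj x y]) deg a.
  rewrite -sum1_card (eq_bigr (fun a => \sum_(b | adj u b && adj a b) 1)).
    rewrite pair_big_dep; apply: eq_bigl => -[a b].
    by rewrite !inE /= (adj_sym b u) [adj a b && _]andbC.
  by move=> a _; rewrite sum1dep_card; apply: eq_card => b; rewrite !inE.
have A_big : Delta <= 2 * m * #|A|.
  rewrite leqNgt; apply/negP => A_small.
  have split_sum : 2 * m * #|three_paths x u| <= 2 * m * #|A| * Delta + Delta * Delta.
    rewrite paths_sum big_distrr /= (bigID (mem A)) /=; apply: leq_add.
      rewrite -mulnA -sum_nat_const big_distrr /= big_mkcond [X in _ <= X]big_mkcond /=.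
      apply: leq_sum => a _; case: (a \in A); rewrite ?andbT ?andbF //.
      by case: ifP => // _; rewrite leq_mul2l deg_le orbT.
    apply: (@leq_trans (\sum_(a in [set y | adj x y]) Delta)).
      rewrite big_mkcondr; apply: leq_sum => a ax; case: ifPn => // aA.
      by move: aA; rewrite inE ax -ltnNge => /ltnW.
    by rewrite sum_nat_const leq_mul2r degG orbT.
  have : 2 * m * #|A| * Delta <= Delta * Delta by rewrite leq_mul2r ltnW ?orbT.
  by rewrite -mulnn in many; lia.
have [|S [T [cS cT _ _ ST]]] :=
  D0P Delta G (@adj G) A [set y | adj u y] D0D (degG u) A_big.
  by move=> a; rewrite inE => /andP[].
exact: complete_bipartite_contains bip cS cT ST x.
Qed.

(** * Bounds on the acyclic chromatic index *)

Lemma degree_le (G : sgraph) (x : G) : #|[set y | adj x y]| <= max_degree G.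
Proof. exact: (leq_bigmax x). Qed.

Lemma acyclic_chromatic_index_le (G : sgraph) k :
  acyclic_edge_colorable G k -> acyclic_chromatic_index G <= k.
Proof.
by rewrite /acyclic_chromatic_index; case: ex_minnP => n _ nmin ck; apply/nmin/asboolP.
Qed.

(** Small [Delta] also needs a bound, uniform in the graph, for the error term to
    be defined; it comes from the trivial count [M = Delta ^ 2]. *)
Lemma index_trivial_bound (G : sgraph) Delta : max_degree G = Delta ->
  acyclic_chromatic_index G <= 3 * Delta + 2 * (2 * Delta).+1.
Proof.
move=> dG; apply: acyclic_chromatic_index_le.
apply: (@few_three_paths_colorable _ _ (Delta ^ 2)) => [x|x u||//].
- by rewrite -dG degree_le.
- apply: leq_trans (_ : #|setX [set y | adj x y] [set y | adj u y]| <= _).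
    apply: subset_leq_card; apply/subsetP => -[a b]; rewrite !inE /= => /and3P[-> _].
    by rewrite adj_sym.
  by rewrite cardsX -mulnn leq_mul // -dG degree_le.
- by nia.
Qed.

(** The condition [2 * M <= b ^ 2] with [b] about [Delta / k] asks for
    [M <= Delta ^ 2 / (2 * k ^ 2)]. *)
Lemma index_asymptotic_bound (H : sgraph) k : bipartite H -> 0 < k ->
  exists D0, forall (G : sgraph) Delta, D0 <= Delta -> max_degree G = Delta ->
    ~ contains_subgraph G H ->
    acyclic_chromatic_index G <= 3 * Delta + 2 * (Delta %/ k).+1.
Proof.
move=> bipH k_gt0.
have [|D0 D0P] := few_three_paths bipH (_ : 0 < 2 * k ^ 2).
  by rewrite muln_gt0 expn_gt0 k_gt0.
exists D0 => G Delta D0D dG freeG; apply: acyclic_chromatic_index_le.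
have degG (x : G) : #|[set y | adj x y]| <= Delta by rewrite -dG degree_le.
apply: (@few_three_paths_colorable _ _ (Delta ^ 2 %/ (2 * k ^ 2))) => //.
  move=> x u; rewrite leq_divRL ?muln_gt0 ?expn_gt0 ?k_gt0 // mulnC.
  exact: D0P.
have k2_gt0 : 0 < k ^ 2 by rewrite expn_gt0 k_gt0.
rewrite -(leq_pmul2l k2_gt0) mulnA [k ^ 2 * 2]mulnC.
rewrite mulnC (leq_trans (leq_trunc_div _ _)) // -expnMn leq_exp2r //.
by rewrite mulnC ltnW // ltn_ceil.
Qed.

(** * The error term *)

From mathcomp Require Import all_order all_algebra.
From mathcomp Require Import boolp classical_sets reals topology normedtype sequences.
From mathcomp Require Import lra.
Import Order.TTheory GRing.Theory Num.Theory.
Import numFieldNormedType.Exports.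

Local Open Scope classical_set_scope.
Local Open Scope ring_scope.

Theorem theorem2 (R : realType) (H : sgraph) (bipH : bipartite H) :
  exists o : nat -> R,
    (fun n : nat => o n / n%:R) @ \oo --> (0 : R) /\
    forall (G : sgraph) (Delta : nat),
      max_degree G = Delta -> ~ contains_subgraph G H ->
      (acyclic_chromatic_index G)%:R <= 3 * Delta%:R + o Delta.
Proof.
(* The error term is [2 * b] for the least [b] that works for all graphs
   without [H] of maximum degree [n]; a bound by [n / k + 1] for each fixed [k]
   and all large [n] then passes to it. *)
pose excess n b := `[< forall G : sgraph, max_degree G = n ->
  ~ contains_subgraph G H ->
  (acyclic_chromatic_index G <= 3 * n + 2 * b)%N >].
have excess_ex n : exists b, excess n b.
  by exists (2 * n).+1; apply/asboolP => G dG _; apply: index_trivial_bound.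
exists (fun n => (2 * ex_minn (excess_ex n))%:R); split; last first.
  move=> G Delta dG freeG; case: ex_minnP => b /asboolP bP _.
  by rewrite -natrM -natrD ler_nat; apply: bP.
apply/cvgrPdist_le => eps eps_gt0.
(* Beyond [k] the rounded quotient satisfies [b <= n / k + 1 <= 2 * n / k], so
   the error term is at most [4 * n / k]. *)
pose k := (Num.trunc (4 / eps)).+1.
have k_eps : 4 / eps < k%:R by apply: truncnS_gt.
have [D0 D0P] := index_asymptotic_bound bipH (ltn0Sn _ : (0 < k)%N).
exists (maxn D0 k) => // n /=; rewrite geq_max => /andP[D0n kn].
rewrite sub0r normrN ger0_norm ?divr_ge0 ?ler0n //.
have n_gt0 : (0 : R) < n%:R by rewrite ltr0n (leq_trans _ kn).
rewrite ler_pdivrMr //; case: ex_minnP => b _ bmin.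
have b_le : (b <= (n %/ k).+1)%N.
  by apply/bmin/asboolP => G dG; apply: D0P.
have kb : (k * b <= 2 * n)%N.
  have := leq_trunc_div n k; rewrite mulnC => ?.
  by apply: leq_trans (leq_mul (leqnn k) b_le) _; rewrite mulnS mul2n -addnn leq_add.
have k_gt0 : (0 : R) < k%:R by rewrite ltr0n.
have : (k%:R * b%:R : R) <= 2 * n%:R by rewrite -!natrM ler_nat.
rewrite ltr_pdivrMr // in k_eps.
move=> kbR; rewrite natrM -(ler_pM2l k_gt0).
nra.
Qed.
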